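(* Let $X$ and $U^1,\dots,U^m$ be convex sets, each equipped with a proximal setup: $X$ with norm $\|\cdot\|_X$, distance-generating function $\omega$ and set width $\Omega_X$; $U^i$ with norm $\|\cdot\|_{(i)}$, distance-generating function $\omega^i$ and set width at most $\Omega_U<\infty$. For $i\in[m]$ let $f^i:X\times U^i\to\mathbb{R}$ be convex in $x$ and concave in $u^i$, with $\|\nabla_xf^i(x,u^i)\|_{X,*}\le G_X<\infty$ and $\|\nabla_uf^i(x,u^i)\|_{(i),*}\le G_U<\infty$ for all $x\in X,u^i\in U^i$. Suppose there is $L_U\in(0,\infty)$ with $\|\nabla_uf^i(x,u^i)-\nabla_uf^i(x,(u^i)')\|_{(i),*}\le L_U\|u^i-(u^i)'\|_{(i)}$ for all $i\in[m]$, $x\in X$, $u^i,(u^i)'\in U^i$. Suppose also that for each $i\in[m]$ there is $\alpha_X^i>0$ such that $f^i(x,u^i)-\alpha_X^i\omega(x)$ is convex in $x$ for every fixed $u^i\in U^i$, and set $\alpha_X=\min_i\alpha_X^i$. Then for every $\epsilon>0$ the $\epsilon$-robust feasibility problem is solved (in the sense of the decision rule given in the context, for any fixed $\tau\in(0,1)$) within $T=O(1/\epsilon)$ iterations, the hidden constant being independent of $\epsilon$, using the weights $\theta_t=\frac{2t}{T(T+1)}$ and the following iterations: $x_1$ is the $\omega$-center of $X$, $v_1^i$ is the $\omega^i$-center of $U^i$, and for $t\ge1$, with $\gamma=\frac{1}{L_U\sup_{s\in[T]}\theta_s}$, $$u_t^i=\mathrm{Prox}^{U^i}_{v_t^i}\!\left(-\gamma\theta_t\nabla_uf^i(x_t,v_t^i)\right),\qquad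 v_{t+1}^i=\mathrm{Prox}^{U^i}_{v_t^i}\!\left(-\gamma\theta_t\nabla_uf^i(x_t,u_t^i)\right)\qquad(i\in[m]),$$ $$x_{t+1}=\mathrm{Prox}^{X}_{x_t}\!\left(\tfrac{2}{\alpha_X(t+1)}\nabla_xf^{i(t)}(x_t,u_t^{i(t)})\right),\qquad i(t)\in\arg\max_{i\in[m]}f^i(x_t,u_t^i).$$ Here $x_t$ is computed with knowledge of $x_{t-1},u_{t-1}$, while $u_t$ is computed with the knowledge of $u_{t-1},x_{t-1},x_t$.
   Context: $[m]=\{1,\dots,m\}$; $u_t=[u_t^1;\dots;u_t^m]$. $\epsilon$-robust feasibility problem: either find $x\in X$ with $\sup_{u^i\in U^i}f^i(x,u^i)\le\epsilon$ for all $i\in[m]$, or correctly declare infeasibility, i.e. that for every $x\in X$ there is $i\in[m]$ with $\sup_{u^i\in U^i}f^i(x,u^i)>0$. Decision rule: after $T$ iterations with weights $\theta$, if $\max_{i\in[m]}\sum_{t=1}^T\theta_tf^i(x_t,u_t^i)\le(1-\tau)\epsilon$, output $\bar x_T=\sum_{t=1}^T\theta_tx_t$ as an $\epsilon$-feasible point; otherwise declare infeasibility. ''Solved'' means that whichever of the two outputs is produced is correct. $\nabla_xf^i$ is a (selected) subgradient of $f^i(\cdot,u^i)$; $\nabla_uf^i$ is a (selected) supergradient of the concave function $f^i(x,\cdot)$. A subscript $*$ on a norm denotes the dual norm. Proximal setup for a convex domain $Z$ in a Euclidean space $E$: (i) a norm $\|\cdot\|$ on $E$ with dual norm $\|\zeta\|_*=\max_{\|z\|\le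 1}\langle\zeta,z\rangle$; (ii) a distance-generating function $\omega:Z\to\mathbb{R}$, convex and continuous on $Z$, admitting a selection of subgradients $\nabla\omega(z)$ that is continuous on $Z^\circ:=\{z\in Z:\partial\omega(z)\ne\emptyset\}$, and strongly convex with modulus 1: $\langle\nabla\omega(z')-\nabla\omega(z''),z'-z''\rangle\ge\|z'-z''\|^2$ for all $z',z''\in Z^\circ$; (iii) Bregman distance $V_z(z'):=\omega(z')-\omega(z)-\langle\nabla\omega(z),z'-z\rangle$ for $z\in Z^\circ$, $z'\in Z$; (iv) prox-mapping $\mathrm{Prox}^Z_z(\xi):=\arg\min_{z'\in Z}\{\langle\xi,z'\rangle+V_z(z')\}$, a map $E\to Z^\circ$, for $z\in Z^\circ$; (v) $\omega$-center $z_\omega:=\arg\min_{z\in Z}\omega(z)$; (vi) set width $\Omega:=\max_{z\in Z}V_{z_\omega}(z)$. Existence of these minimizers and of the maximum is part of the setup. *)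

(* Defs.v *)
From HB Require Import structures.
From mathcomp Require Import all_boot all_order all_algebra.
From mathcomp Require Import all_classical all_reals all_analysis.
Set Implicit Arguments.
Unset Strict Implicit.
Unset Printing Implicit Defensive.
Import Order.TTheory GRing.Theory Num.Theory.
Import numFieldNormedType.Exports.
Local Open Scope classical_set_scope.
Local Open Scope ring_scope.

(* Conventions.
   - A Euclidean space is 'rV[R]_n with the standard inner product [dotp]; its
     topology is the library's (product) topology.
   - A function on a set Z is a total function of which only the values on Z
     are ever constrained or used.
   - The index set [m], m >= 1, is 'I_m.+1 (so there are m.+1 constraints);
     time indices t = 1, 2, ... are naturals, the value at 0 being junk. *)

Section ConvexAnalysis.
Context {R : realType} {n : nat}.
Implicit Types (Z : set 'rV[R]_n) (phi : 'rV[R]_n -> R) (x y z g : 'rV[R]_n).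

Definition dotp x y : R := \sum_(k < n) x ord0 k * y ord0 k.

Record is_norm (N : 'rV[R]_n -> R) : Prop := IsNorm {
  norm_triangle : forall x y, N (x + y) <= N x + N y ;
  norm_homogeneous : forall (a : R) x, N (a *: x) = `|a| * N x ;
  norm_definite : forall x, N x = 0 -> x = 0
}.

(* When N is a norm the set below is nonempty and bounded above, so that [sup]
   is a genuine supremum, and it is attained. *)
Definition dual_norm (N : 'rV[R]_n -> R) (zeta : 'rV[R]_n) : R :=
  sup [set dotp zeta z | z in [set z | N z <= 1]].

Definition argmin Z phi : set 'rV[R]_n :=
  [set p | Z p /\ forall z, Z z -> phi p <= phi z].

Definition subdiff Z phi z : set 'rV[R]_n :=
  [set g | forall z', Z z' -> phi z + dotp g (z' - z) <= phi z'].

Definition superdiff Z phi z : set 'rV[R]_n :=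
  [set g | forall z', Z z' -> phi z' <= phi z + dotp g (z' - z)].

(* The set Z° of points of Z at which phi is subdifferentiable. *)
Definition subdiff_dom Z phi : set 'rV[R]_n :=
  [set z | Z z /\ subdiff Z phi z !=set0].

(* Bregman distance V_z(z') of omega, for the selection domega of
   subgradients. *)
Definition bregman (omega : 'rV[R]_n -> R) (domega : 'rV[R]_n -> 'rV[R]_n)
    z z' : R :=
  omega z' - omega z - dotp (domega z) (z' - z).

End ConvexAnalysis.

(* [prox z xi] is Prox^Z_z(xi). *)
Record prox_setup (R : realType) (n : nat) (Z : set 'rV[R]_n) := ProxSetup {
  pnorm : 'rV[R]_n -> R ;
  pnorm_norm : is_norm pnorm ;
  dgf : 'rV[R]_n -> R ;
  dgf_convex : convex_function Z dgf ;
  dgf_continuous : {within Z, continuous dgf} ;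
  dgrad : 'rV[R]_n -> 'rV[R]_n ;
  dgrad_subdiff : forall z, subdiff_dom Z dgf z -> subdiff Z dgf z (dgrad z) ;
  dgrad_continuous : {within subdiff_dom Z dgf, continuous dgrad} ;
  dgf_strongly_convex : forall z' z'' : 'rV[R]_n,
    subdiff_dom Z dgf z' -> subdiff_dom Z dgf z'' ->
    pnorm (z' - z'') ^+ 2 <= dotp (dgrad z' - dgrad z'') (z' - z'') ;
  prox : 'rV[R]_n -> 'rV[R]_n -> 'rV[R]_n ;
  prox_dom : forall z xi : 'rV[R]_n,
    subdiff_dom Z dgf z -> subdiff_dom Z dgf (prox z xi) ;
  prox_argmin : forall z xi : 'rV[R]_n, subdiff_dom Z dgf z ->
    argmin Z (fun z' => dotp xi z' + bregman dgf dgrad z z') (prox z xi) ;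
  center : 'rV[R]_n ;
  center_argmin : argmin Z dgf center ;
  width : R ;
  width_ub : forall z, Z z -> bregman dgf dgrad center z <= width ;
  width_attained : exists2 z, Z z & bregman dgf dgrad center z = width
}.

Section RobustFeasibility.
Context {R : realType} {n m : nat} {d : 'I_m.+1 -> nat}.
Variables (X : set 'rV[R]_n) (U : forall i, set 'rV[R]_(d i)).
Variable f : forall i, 'rV[R]_n -> 'rV[R]_(d i) -> R.
Arguments U : clear implicits.
Arguments f : clear implicits.

Definition worst_case (i : 'I_m.+1) (x : 'rV[R]_n) : \bar R :=
  ereal_sup [set (f i x u)%:E | u in U i].

Definition robust_feasible (eps : R) (x : 'rV[R]_n) : Prop :=
  X x /\ forall i, (worst_case i x <= eps%:E)%E.

Definition robust_infeasible : Prop :=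
  forall x, X x -> exists i, (0%:E < worst_case i x)%E.

(* An output is either a point or, for None, the declaration of
   infeasibility. *)
Definition correct_output (eps : R) (o : option 'rV[R]_n) : Prop :=
  match o with
  | Some x => robust_feasible eps x
  | None => robust_infeasible
  end.

Definition decision (eps tau : R) (T : nat) (theta : nat -> R)
    (x : nat -> 'rV[R]_n) (u : forall i, nat -> 'rV[R]_(d i)) :
    option 'rV[R]_n :=
  let S (i : 'I_m.+1) := \sum_(1 <= t < T.+1) theta t * f i (x t) (u i t) in
  if \big[Num.max/S ord0]_(i < m.+1) S i <= (1 - tau) * eps
  then Some (\sum_(1 <= t < T.+1) theta t *: x t)
  else None.

Definition linear_weight (T t : nat) : R := (2 * t)%:R / (T * T.+1)%:R.

Definition dual_step (LU : R) (T : nat) : R :=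
  (LU * sup [set linear_weight T s | s in [set s | (1 <= s <= T)%N]])^-1.

(* x, u, v, it are the iterates x_t, u_t^i, v_t^i and the index i(t) of the
   method with horizon T. *)
Record robust_run (SX : prox_setup X) (SU : forall i, prox_setup (U i))
    (gx : forall i, 'rV[R]_n -> 'rV[R]_(d i) -> 'rV[R]_n)
    (gu : forall i, 'rV[R]_n -> 'rV[R]_(d i) -> 'rV[R]_(d i))
    (LU alphaX : R) (T : nat)
    (x : nat -> 'rV[R]_n) (u v : forall i, nat -> 'rV[R]_(d i))
    (it : nat -> 'I_m.+1) : Prop := RobustRun {
  run_x1 : x 1%N = center SX ;
  run_v1 : forall i, v i 1%N = center (SU i) ;
  run_u : forall i t, (1 <= t <= T)%N ->
    u i t = prox (SU i) (v i t)
      (- ((dual_step LU T * linear_weight T t) *: gu i (x t) (v i t))) ;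
  run_v : forall i t, (1 <= t <= T)%N ->
    v i t.+1 = prox (SU i) (v i t)
      (- ((dual_step LU T * linear_weight T t) *: gu i (x t) (u i t))) ;
  run_it : forall t, (1 <= t <= T)%N ->
    forall j, f j (x t) (u j t) <= f (it t) (x t) (u (it t) t) ;
  run_x : forall t, (1 <= t <= T)%N ->
    x t.+1 = prox SX (x t)
      ((2 / (alphaX * t.+1%:R)) *: gx (it t) (x t) (u (it t) t))
}.

End RobustFeasibility.

(* Main.v *)
Require Import Defs.
From HB Require Import structures.
From mathcomp Require Import all_boot all_order all_algebra.
From mathcomp Require Import all_classical all_reals all_analysis.
From mathcomp Require Import ring lra.
Set Implicit Arguments.
Unset Strict Implicit.
Unset Printing Implicit Defensive.
Import Order.TTheory GRing.Theory Num.Theory.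
Import numFieldNormedType.Exports.
Local Open Scope classical_set_scope.
Local Open Scope ring_scope.

(** The decision rule compares [(1 - tau) * eps] with weighted sums along the
run, and it is correct as soon as two regrets are small.

- If the rule outputs the average of the [x t], then for a constraint [i] and a
  point [y] of [U i], convexity in [x] bounds [f i] at the average by the
  weighted sum of the [f i (x t) y], which exceeds that of the
  [f i (x t) (u i t)] by at most the regret of the [i]-th maximiser. So regrets
  at most [tau * eps] suffice.
- If the rule declares infeasibility although some [y] in [X] satisfies every
  constraint, then the weighted sum of the maxima [f (it t) (x t) (u (it t) t)]
  is at most the regret of the minimiser against [y]. So a regret at most
  [(1 - tau) * eps] contradicts the test.

Both regrets are of order [1 / T]. The iteration on each [U i] is mirror-prox
for a Lipschitz gradient field, whose per-step errors are absorbed by the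
distances travelled, so that only [width / gamma], of order [1 / T], remains
([mirror_prox_regret]). The iteration on [X] is mirror descent for strongly
convex functions with step sizes of order [1 / t]; with weights proportional to
[t] the Bregman terms telescope ([strongly_convex_regret]).

The analysis of one prox step rests on the three-point inequality
[prox_three_point] and on [V_z(y) >= N(y - z)^2 / 2] for the norm [N] of the
setup ([bregman_ge]). Neither is immediate here, because [Z] need not be closed,
the distance-generating function has subgradients only on a subset of [Z], and
strong monotonicity is given only for one selection of subgradients. What makes
both work is that points of subdifferentiability can be found after arbitrarily
small contractions of [Z] ([subdiff_dom_contraction]). With the continuity of
the selection this yields that the selected subgradient is the exact directional
derivative ([dgf_directional]), hence the optimality condition of the
prox-mapping ([prox_variational]); and it supplies midpoints at which strong
monotonicity can be applied repeatedly ([bregman_ge_improve]). *)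

(** * Convex combinations *)

Section Convexity.
Context {R : realType} {n : nat}.
Implicit Types (Z : set 'rV[R]_n) (phi : 'rV[R]_n -> R) (a b x y z : 'rV[R]_n).

Lemma convex_setP Z : convex_set Z -> forall (s : R) a b, 0 <= s -> s <= 1 ->
  Z a -> Z b -> Z ((1 - s) *: a + s *: b).
Proof.
move=> cZ s a b s0 s1 Za Zb.
have := cZ b a (Itv01 s0 s1); rewrite !inE => /(_ Zb Za).
by rewrite /conv/= addrC.
Qed.

Lemma convex_functionP Z phi : convex_function Z phi ->
  forall (s : R) a b, 0 <= s -> s <= 1 -> Z a -> Z b ->
  phi ((1 - s) *: a + s *: b) <= (1 - s) * phi a + s * phi b.
Proof.
move=> cphi s a b s0 s1 Za Zb.
have := cphi (Itv01 s0 s1) b a; rewrite !inE => /(_ Zb Za).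
by rewrite /conv/= addrC [leRHS]addrC.
Qed.

(** Giving the base point a strictly positive weight lets the induction peel
off one point at a time without ever dividing by zero. *)
Lemma convex_set_sum Z : convex_set Z -> forall N (z : 'rV[R]_n) (mu : R)
    (w : 'I_N -> R) (p : 'I_N -> 'rV[R]_n),
  Z z -> 0 < mu -> (forall t, 0 <= w t) -> (forall t, Z (p t)) ->
  mu + \sum_t w t = 1 -> Z (mu *: z + \sum_t w t *: p t).
Proof.
move=> cZ; elim=> [|N IH] z mu w p Zz mu0 w0 Zp.
  by rewrite !big_ord0 !addr0 => ->; rewrite scale1r.
rewrite !big_ord_recr /=; set s := w _.
pose w' (t : 'I_N) := w (widen_ord (leqnSn N) t).
rewrite addrA -[\sum_(t < N) w _]/(\sum_(t < N) w' t) => e.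
have w'0 : 0 <= \sum_(t < N) w' t by rewrite sumr_ge0 // => t _; exact: w0.
have s0 : 0 <= s by exact: w0.
have l0 : 0 < 1 - s by rewrite -e addrK ltr_pwDl.
have /(_ z (mu / (1 - s)) (fun t => w' t / (1 - s)) _ Zz) := IH.
move=> /(_ (fun t => p (widen_ord (leqnSn N) t))) IH1.
have {}IH1 := IH1 (divr_gt0 mu0 l0) (fun t => divr_ge0 (w0 _) (ltW l0))
   (fun t => Zp _).
have : Z ((1 - s) *: ((mu / (1 - s)) *: z +
      \sum_(t < N) (w' t / (1 - s)) *: p (widen_ord (leqnSn N) t))
     + s *: p ord_max).
  apply: convex_setP => //; first by lra.
  by apply: IH1; rewrite -mulr_suml -mulrDl -e addrK divff // -[X in X != 0](addrK s) e gt_eqF.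
rewrite scalerDr scalerA mulrC divfK ?gt_eqF // scaler_sumr addrA.
rewrite (eq_bigr (fun t => w' t *: p (widen_ord (leqnSn N) t))) // => t _.
by rewrite scalerA mulrC divfK ?gt_eqF.
Qed.

End Convexity.

(** * Inner product and sup norm *)

Section InnerProduct.
Context {R : realType} {n : nat}.
Implicit Types (x y z : 'rV[R]_n).

Lemma dotpC x y : dotp x y = dotp y x.
Proof. by apply: eq_bigr => k _; rewrite mulrC. Qed.

Lemma dotpDr x y z : dotp x (y + z) = dotp x y + dotp x z.
Proof. by rewrite -big_split; apply: eq_bigr => k _; rewrite mxE mulrDr. Qed.

Lemma dotpZr x (a : R) y : dotp x (a *: y) = a * dotp x y.
Proof. by rewrite /dotp mulr_sumr; apply: eq_bigr => k _; rewrite mxE mulrCA. Qed.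

Lemma dotpNr x y : dotp x (- y) = - dotp x y.
Proof. by rewrite -scaleN1r dotpZr mulN1r. Qed.

Lemma dotpBr x y z : dotp x (y - z) = dotp x y - dotp x z.
Proof. by rewrite dotpDr dotpNr. Qed.

Lemma dotpDl x y z : dotp (y + z) x = dotp y x + dotp z x.
Proof. by rewrite !(dotpC _ x) dotpDr. Qed.

Lemma dotpZl x (a : R) y : dotp (a *: y) x = a * dotp y x.
Proof. by rewrite !(dotpC _ x) dotpZr. Qed.

Lemma dotpNl x y : dotp (- y) x = - dotp y x.
Proof. by rewrite !(dotpC _ x) dotpNr. Qed.

Lemma dotpBl x y z : dotp (y - z) x = dotp y x - dotp z x.
Proof. by rewrite !(dotpC _ x) dotpBr. Qed.

Lemma dotp0l x : dotp 0 x = 0.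
Proof. by rewrite -(scale0r 0) dotpZl mul0r. Qed.

Lemma dotp0r x : dotp x 0 = 0.
Proof. by rewrite dotpC dotp0l. Qed.

Lemma dotp_sumr x T (r : seq T) (F : T -> 'rV[R]_n) :
  dotp x (\sum_(t <- r) F t) = \sum_(t <- r) dotp x (F t).
Proof.
elim: r => [|t r IH]; first by rewrite !big_nil dotp0r.
by rewrite !big_cons dotpDr IH.
Qed.

Lemma dotp_mulmx k (v : 'rV[R]_n) (B : 'M[R]_(n, k)) (w : 'rV[R]_k) :
  dotp w (v *m B) = dotp (w *m B^T) v.
Proof.
transitivity ((w *m (v *m B)^T) ord0 ord0).
  rewrite [RHS]mxE; apply: eq_bigr => j _; by rewrite [in RHS]mxE.
rewrite trmx_mul mulmxA mxE; apply: eq_bigr => j _.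
by rewrite [v^T _ _]mxE.
Qed.

Lemma coord_le_norm x k : `|x ord0 k| <= `|x|.
Proof.
rewrite [leRHS]/Num.norm /= mx_normrE.
exact: (le_bigmax 0 (fun ij : 'I_1 * 'I_n => `|x ij.1 ij.2|) (ord0, k)).
Qed.

Lemma dotp_le_norm x y : `|dotp x y| <= n%:R * `|x| * `|y|.
Proof.
apply: le_trans (ler_norm_sum _ _ _) _.
rewrite -mulrA mulr_natl -[X in _ *+ X]card_ord -sumr_const ler_sum // => k _.
by rewrite normrM ler_pM // coord_le_norm.
Qed.

End InnerProduct.

(** * Continuity and minima on boxes *)

Section Box.
Context {R : realType}.

Lemma within_continuousP n (V : pseudoMetricNormedZmodType R)
    (Z : set 'rV[R]_n) (phi : 'rV[R]_n -> V) :
  {within Z, continuous phi} <-> forall z, Z z -> forall e : R, 0 < e ->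
    exists2 r : R, 0 < r & forall y, Z y -> `|y - z| < r -> `|phi y - phi z| < e.
Proof.
rewrite subspace_continuousP; split => H z Zz.
  move=> e e0; have /cvgrPdist_lt/(_ e e0) := H z Zz.
  rewrite near_withinE => /nbhs_ballP [r /= r0 Hr]; exists r => // y Zy yz.
  rewrite distrC; apply: Hr => //.
  by rewrite mx_norm_ball /ball_ /= distrC.
apply/cvgrPdist_lt => e e0; have [r r0 Hr] := H z Zz e e0.
rewrite near_withinE; apply/nbhs_ballP; exists r => //= y.
rewrite mx_norm_ball /ball_ /= distrC => yz Zy.
by rewrite distrC; exact: Hr.
Qed.

Lemma dotp_sub_continuous n (Z : set 'rV[R]_n) (g a : 'rV[R]_n) :
  {within Z, continuous (fun y => dotp g (y - a))}.
Proof.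
apply/within_continuousP => z _ e e0.
have D0 : 0 < n%:R * `|g| + 1 by rewrite ltr_wpDl // mulr_ge0.
exists (e / (n%:R * `|g| + 1)); first by rewrite divr_gt0.
move=> y _; rewrite ltr_pdivlMr // => yz.
rewrite -dotpBr opprB addrA subrK (le_lt_trans (dotp_le_norm _ _)) //.
by apply: le_lt_trans yz; rewrite mulrC ler_wpM2l // lerDl.
Qed.

Lemma dotp_sqr_sub_continuous n (Z : set 'rV[R]_n) (a : 'rV[R]_n) :
  {within Z, continuous (fun y => dotp (y - a) (y - a))}.
Proof.
apply/within_continuousP => z _ e e0.
have M0 : 0 <= n%:R * (1 + 2 * `|z - a|) by rewrite !(mulr_ge0, addr_ge0).
have D0 : 0 < n%:R * (1 + 2 * `|z - a|) + 1 by rewrite ltr_wpDl.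
exists (Num.min 1 (e / (n%:R * (1 + 2 * `|z - a|) + 1))).
  by rewrite lt_min ltr01 divr_gt0.
move=> y _; rewrite lt_min ltr_pdivlMr // => /andP[yz1 yz].
rewrite (_ : y - a = (y - z) + (z - a)); last by rewrite addrA subrK.
move: (y - z) (z - a) yz1 yz M0 => v b v1 ve M0.
rewrite !dotpDl !dotpDr (dotpC b v) addrA addrK -addrA.
have h1 := dotp_le_norm v v; have h2 := dotp_le_norm v b.
rewrite (le_lt_trans (ler_normD _ _)) //.
have h3 : `|dotp v b + dotp v b| <= 2 * `|dotp v b|.
  by rewrite (le_trans (ler_normD _ _)) // mulr_natl mulr2n.
have h4 : n%:R * `|v| * `|v| <= n%:R * `|v| by rewrite ler_piMr ?mulr_ge0 // ltW.
have v0 : 0 <= `|v| by [].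
apply: le_lt_trans ve; nra.
Qed.

Lemma box_min k (a b : 'I_k -> R) (phi : 'rV[R]_k -> R) :
  (forall i, a i <= b i) ->
  {within [set c : 'rV[R]_k | forall i, a i <= c ord0 i <= b i], continuous phi} ->
  exists2 c : 'rV[R]_k, (forall i, a i <= c ord0 i <= b i) &
    forall c' : 'rV[R]_k, (forall i, a i <= c' ord0 i <= b i) -> phi c <= phi c'.
Proof.
move=> ab cphi.
have cpt : compact [set c : 'rV[R]_k | forall i, a i <= c ord0 i <= b i].
  have := @rV_compact R k (fun i => `[a i, b i]%classic) (fun i => @segment_compact R _ _).
  by congr compact; apply/seteqP; split => c /= h i; have := h i; rewrite in_itv.
have [|c] := compact_EVT_min _ cpt cphi.
  by exists (\row_i a i) => i /=; rewrite mxE lexx ab.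
rewrite inE => cab cmin; exists c => // c' c'ab; apply: cmin.
by rewrite inE.
Qed.

End Box.

(** * Norms and dual norms *)

Section Norms.
Context {R : realType} {n : nat} {N : 'rV[R]_n -> R} (N_norm : is_norm N).

Lemma norm_fun0 : N 0 = 0.
Proof. by rewrite -(scale0r 0) (norm_homogeneous N_norm) normr0 mul0r. Qed.

Lemma norm_funN x : N (- x) = N x.
Proof. by rewrite -scaleN1r (norm_homogeneous N_norm) normrN1 mul1r. Qed.

Lemma norm_fun_ge0 x : 0 <= N x.
Proof.
have := norm_triangle N_norm x (- x).
by rewrite subrr norm_fun0 norm_funN -mulr2n pmulrn_lge0.
Qed.

Lemma norm_fun_sum T (r : seq T) (F : T -> 'rV[R]_n) :
  N (\sum_(t <- r) F t) <= \sum_(t <- r) N (F t).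
Proof.
elim: r => [|t r IH]; first by rewrite !big_nil norm_fun0.
by rewrite !big_cons (le_trans (norm_triangle N_norm _ _)) // lerD2l.
Qed.

Lemma norm_fun_le : exists2 M : R, 0 < M & forall x, N x <= M * `|x|.
Proof.
have ge0 : 0 <= \sum_(k < n) N (delta_mx ord0 k).
  by rewrite sumr_ge0 // => k _; exact: norm_fun_ge0.
exists (1 + \sum_(k < n) N (delta_mx ord0 k)); first by rewrite ltr_pwDl.
move=> x; rewrite {1}(row_sum_delta x) (le_trans (norm_fun_sum _ _)) //.
rewrite mulrDl mul1r -[leLHS]add0r lerD // mulr_suml ler_sum // => k _.
rewrite (norm_homogeneous N_norm) mulrC.
by rewrite ler_wpM2l ?norm_fun_ge0 // coord_le_norm.
Qed.

Lemma norm_fun_dist x y : `|N x - N y| <= N (x - y).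
Proof.
have h a b : N a - N b <= N (a - b).
  by have := norm_triangle N_norm (a - b) b; rewrite subrK; lra.
by rewrite ler_norml h andbT lerNl opprB -(norm_funN (x - y)) opprB h.
Qed.

Lemma norm_fun_continuous (Z : set 'rV[R]_n) : {within Z, continuous N}.
Proof.
apply/within_continuousP => z Zz e e0; have [M M0 HM] := norm_fun_le.
exists (e / M); first by rewrite divr_gt0.
move=> y _; rewrite ltr_pdivlMr // => yz.
by rewrite (le_lt_trans (norm_fun_dist _ _)) // (le_lt_trans (HM _)) // mulrC.
Qed.

(** The face [x_k = 1] of the unit cube is a compact box, on which [N] has a
positive minimum; every nonzero vector is a multiple of a point of such a
face. *)
Lemma norm_fun_ge : exists2 M : R, 0 < M & forall x, `|x| <= M * N x.
Proof.
have face k : exists2 M : R, 0 < M & forall x : 'rV[R]_n, `|x| = `|x ord0 k| -> `|x| <= M * N x.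
  pose a (i : 'I_n) : R := if i == k then 1 else -1.
  have [||c cab cmin] := @box_min R n a (fun=> 1) N.
  - by move=> i; rewrite /a; case: ifP => // _; lra.
  - exact: norm_fun_continuous.
  have Nc : 0 < N c.
    rewrite lt_neqAle norm_fun_ge0 andbT eq_sym; apply/eqP => /(norm_definite N_norm) c0.
    by have := cab k; rewrite c0 mxE /a eqxx ler10.
  exists (N c)^-1; first by rewrite invr_gt0.
  move=> x xk; have [x0|xn0] := eqVneq x 0; first by rewrite x0 normr0 norm_fun0 mulr0.
  have xk0 : x ord0 k != 0 by rewrite -normr_eq0 -xk normr_eq0.
  rewrite ler_pdivlMl // -ler_pdivlMr ?normr_gt0 // xk mulrC -normfV -(norm_homogeneous N_norm).
  apply: cmin => i; rewrite /a mxE.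
  case: eqP => [->|_]; first by rewrite mulVf // lexx.
  by rewrite -ler_norml normrM normfV ler_pdivrMl ?normr_gt0 // mulr1 -xk coord_le_norm.
pose F k := sval (cid2 (face k)).
have F0 k : 0 < F k by rewrite /F; case: cid2.
have Fs : 0 <= \sum_k F k by rewrite sumr_ge0 // => k _; exact: ltW.
exists (1 + \sum_k F k); first by rewrite ltr_pwDl.
move=> x; have [x0|xn0] := eqVneq x 0; first by rewrite x0 normr0 norm_fun0 mulr0.
have [[i k] /= xik] : exists i : 'I_1 * 'I_n, `|x| = `|x i.1 i.2|.
  by apply: mx_norm_neq0; rewrite -[mx_norm _]/`|x| normr_eq0.
rewrite ord1 in xik.
have h : `|x| <= F k * N x by rewrite /F; case: cid2 => M /= _; apply.
apply: le_trans h _; rewrite ler_wpM2r ?norm_fun_ge0 // (bigD1 k) //=.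
have : 0 <= \sum_(i < n | i != k) F i by rewrite sumr_ge0 // => j _; exact: ltW.
by lra.
Qed.

Lemma dual_norm_has_ubound g : has_ubound [set dotp g z | z in [set z | N z <= 1]].
Proof.
have [M M0 HM] := norm_fun_ge; exists (n%:R * `|g| * M) => _ [z /= Nz <-].
apply: le_trans (ler_norm _) _; apply: le_trans (dotp_le_norm _ _) _.
rewrite ler_wpM2l // (le_trans (HM z)) // -[leRHS]mulr1 ler_wpM2l //; exact: ltW.
Qed.

Lemma dotp_le_dual_norm g z : dotp g z <= dual_norm N g * N z.
Proof.
have [->|z0] := eqVneq z 0; first by rewrite dotp0r norm_fun0 mulr0.
have Nz : 0 < N z.
  by rewrite lt_neqAle norm_fun_ge0 andbT eq_sym; apply: contra_neq z0; exact: norm_definite.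
rewrite -ler_pdivrMr // mulrC -dotpZr; apply: ub_le_sup; first exact: dual_norm_has_ubound.
exists ((N z)^-1 *: z) => //=.
have Ni : 0 <= (N z)^-1 by rewrite invr_ge0 ltW.
by rewrite (norm_homogeneous N_norm) ger0_norm // mulVf ?lexx // gt_eqF.
Qed.

Lemma dual_norm_ge0 g : 0 <= dual_norm N g.
Proof.
rewrite -(dotp0r g); apply: ub_le_sup; first exact: dual_norm_has_ubound.
by exists 0 => //=; rewrite norm_fun0.
Qed.

Lemma dual_norm_scale (a : R) g : dual_norm N (a *: g) <= `|a| * dual_norm N g.
Proof.
apply: ge_sup; first by exists (dotp (a *: g) 0), 0 => //=; rewrite norm_fun0.
move=> _ [z /= Nz <-]; rewrite dotpZl -dotpZr.
apply: le_trans (dotp_le_dual_norm _ _) _.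
rewrite (norm_homogeneous N_norm) mulrCA ler_wpM2l //.
by rewrite ler_piMr // dual_norm_ge0.
Qed.

End Norms.

(** * Points of subdifferentiability *)

Lemma ler_addgt0_linear (R : realType) (x y b s0 : R) : 0 < s0 ->
  (forall s, 0 < s -> s <= s0 -> x <= y + s * b) -> x <= y.
Proof.
move=> s00 H; apply/ler_addgt0Pr => e e0.
have b1 : 0 < `|b| + 1 by rewrite ltr_wpDl.
pose s := Num.min s0 (e / (`|b| + 1)).
have se : s <= e / (`|b| + 1) by rewrite /s ge_min lexx orbT.
have s_gt0 : 0 < s by rewrite lt_min s00 divr_gt0.
apply: le_trans (H s s_gt0 _) _; first by rewrite /s ge_min lexx.
rewrite lerD2l (le_trans (ler_norm _)) // normrM (gtr0_norm s_gt0).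
move: se; rewrite ler_pdivlMr //; apply: le_trans.
by rewrite ler_pM2l // lerDl.
Qed.

Section Subdifferentiability.
Context {R : realType} {n : nat} {Z : set 'rV[R]_n} {phi : 'rV[R]_n -> R}.
Hypotheses (Z_convex : convex_set Z) (phi_convex : convex_function Z phi)
  (phi_cont : {within Z, continuous phi}).

(** A linearly independent family of directions from [z1] to points of [Z],
taken of maximal size, spans all such directions. *)
Lemma affine_frame z1 : exists k (B : 'M[R]_(k, n)),
  (forall j, Z (z1 + row j B)) /\ forall y, Z y -> (y - z1 <= B)%MS.
Proof.
pose P k := `[< exists B : 'M[R]_(k, n), row_free B /\ forall j, Z (z1 + row j B) >].
have P0 : exists k, P k.
  exists 0%N; apply/asboolP; exists 0; split; last by case.
  by rewrite /row_free mxrank0.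
have Pn k : P k -> (k <= n)%N.
  by move=> /asboolP [B [/eqP rB _]]; rewrite -[k]rB rank_leq_col.
case: (ex_maxnP P0 Pn) => k /asboolP[B [fB ZB]] kmax.
exists k, B; split => // y Zy; apply: contraT => yB.
suff /kmax : P (1 + k)%N by rewrite ltnn.
apply/asboolP; exists (col_mx (y - z1) B); split.
  rewrite -row_leq_rank -addsmxE add1n.
  have : (B < (y - z1) + B)%MS by rewrite ltmxE addsmxSr /= addsmx_sub negb_and yB.
  by move=> /rank_ltmx; rewrite (eqP fB).
move=> j; case: (split_ordP j) => i ->.
  by rewrite rowKu ord1 row_id addrC subrK.
by rewrite rowKd.
Qed.

Lemma norm_mulmx_le k (v : 'rV[R]_k) (B : 'M[R]_(k, n)) :
  `|v *m B| <= `|v| * \sum_j `|row j B|.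
Proof.
rewrite mulmx_sum_row (le_trans (ler_norm_sum _ _ _)) // mulr_sumr ler_sum // => j _.
by rewrite normrZ ler_wpM2r // coord_le_norm.
Qed.

Lemma frame_simplex k (B : 'M[R]_(k, n)) z1 (c : 'rV[R]_k) : Z z1 ->
  (forall j, Z (z1 + row j B)) -> (forall j, 0 <= c ord0 j <= k.+1%:R^-1) ->
  Z (z1 + c *m B).
Proof.
move=> Zz1 ZB c0.
have sc : \sum_j c ord0 j < 1.
  apply: (@le_lt_trans _ _ (\sum_(j < k) k.+1%:R^-1)).
    by apply: ler_sum => j _; case/andP: (c0 j).
  by rewrite sumr_const card_ord -[ltLHS]mulr_natl ltr_pdivrMr ?ltr0n // mul1r ltr_nat.
rewrite -subr_gt0 in sc.
have := @convex_set_sum _ _ _ Z_convex k z1 _ (fun j => c ord0 j) (fun j => z1 + row j B) Zz1 sc.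
move=> /(_ (fun j => proj1 (andP (c0 j))) ZB); rewrite subrK => /(_ erefl).
congr (Z _); rewrite mulmx_sum_row.
rewrite (eq_bigr (fun j => c ord0 j *: z1 + c ord0 j *: row j B)); last first.
  by move=> j _; rewrite scalerDr.
by rewrite big_split /= addrA -scaler_suml -scalerDl subrK scale1r.
Qed.

(** In the coordinates of a frame, the contracted simplex contains a cube. One
minimises [phi] plus a large quadratic over this compact cube; at an interior
minimiser the gradient of the quadratic is, up to sign, a subgradient, and by
convexity local minimality extends to all of [Z]. *)
Lemma subdiff_in_simplex k (B : 'M[R]_(k, n)) z1 y0 (t : R) : Z z1 ->
  (forall j, Z (z1 + row j B)) -> (forall y, Z y -> (y - z1 <= B)%MS) ->
  Z y0 -> 0 < t -> t <= 1 ->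
  exists2 c : 'rV[R]_k, (forall j, 0 <= c ord0 j <= k.+1%:R^-1) &
    subdiff_dom Z phi ((1 - t) *: y0 + t *: (z1 + c *m B)).
Proof.
move=> Zz1 ZB spanB Zy0 t0 t1.
pose a : R := k.+1%:R^-1 / 2.
have a0 : 0 < a by rewrite divr_gt0 // invr_gt0 ltr0n.
have a2 : k.+1%:R^-1 = 2 * a by rewrite /a mulrC divfK // pnatr_eq0.
rewrite a2.
pose box := [set c : 'rV[R]_k | forall j, 0 <= c ord0 j <= 2 * a].
pose c0 : 'rV[R]_k := const_mx a.
pose w (c : 'rV[R]_k) := (1 - t) *: y0 + t *: (z1 + c *m B).
have Zw c : box c -> Z (w c).
  move=> bc; apply: convex_setP => //; first exact: ltW.
  by apply: frame_simplex => //; rewrite a2.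
have box_c0 : box c0 by move=> j; rewrite mxE; apply/andP; split; lra.
pose q (c : 'rV[R]_k) := dotp (c - c0) (c - c0).
have q_cont : {within box, continuous q} by exact: dotp_sqr_sub_continuous.
have pw_cont : {within box, continuous (phi \o w)}.
  apply/within_continuousP => c bc e e0.
  have /within_continuousP/(_ _ (Zw c bc) e e0)[r r0 Hr] := phi_cont.
  have D0 : 0 < \sum_j `|row j B| + 1 by rewrite ltr_wpDl // sumr_ge0.
  exists (r / (\sum_j `|row j B| + 1)); first by rewrite divr_gt0.
  move=> c' bc'; rewrite ltr_pdivlMr // => cc'; apply: Hr; first exact: Zw.
  have -> : w c' - w c = t *: ((c' - c) *m B).
    by rewrite /w mulmxBl opprD addrACA subrr add0r -scalerBr opprD addrACA subrr add0r.
  rewrite normrZ gtr0_norm //; apply: le_lt_trans cc'.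
  rewrite -[leRHS]mul1r ler_pM // ?(ltW t0) // (le_trans (norm_mulmx_le _ _)) //.
  by rewrite ler_wpM2l // lerDl.
have [c1 bc1 c1min] : exists2 c1, box c1 & forall c, box c -> phi (w c1) <= phi (w c).
  by apply: (@box_min R k (fun=> 0) (fun=> 2 * a)) => // j; lra.
(* [K * (a ^+ 2 / 4)] exceeds the drop of [phi] from the centre of the cube to
   its minimum, so that the minimiser of [F] stays in the concentric cube of half
   the size, at a fixed distance from the faces. *)
pose K := (phi (w c0) - phi (w c1) + 1) / (a ^+ 2 / 4).
have a20 : 0 < a ^+ 2 / 4 by rewrite divr_gt0 // exprn_gt0.
have K0 : 0 < K.
  by rewrite /K divr_gt0 //; have := c1min _ box_c0; lra.
pose F c := phi (w c) + K * q c.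
have [c bc cmin] : exists2 c, box c & forall c', box c' -> F c <= F c'.
  apply: (@box_min R k (fun=> 0) (fun=> 2 * a)) => [j|]; first by lra.
  move=> c; apply: (@continuousD R R _ (phi \o w : subspace box -> R) (fun c => K * q c)).
    exact: pw_cont.
  by apply: continuousM; [exact: cst_continuous|exact: q_cont].
have qc : q c < a ^+ 2 / 4.
  have Fc := cmin _ box_c0; have c1c := c1min _ bc.
  have q0 : q c0 = 0 by rewrite /q subrr dotp0l.
  rewrite /F q0 mulr0 addr0 in Fc.
  have KK : K * (a ^+ 2 / 4) = phi (w c0) - phi (w c1) + 1 by rewrite divfK // gt_eqF.
  by rewrite -(ltr_pM2l K0) KK; lra.
have c_int j : `|c ord0 j - a| <= a / 2.
  have : (c ord0 j - a) ^+ 2 <= q c.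
    rewrite /q /dotp (bigD1 j) //= !mxE -expr2 lerDl sumr_ge0 // => i _.
    by rewrite -expr2 sqr_ge0.
  move=> /le_lt_trans /(_ qc); rewrite (_ : a ^+ 2 / 4 = (a / 2) ^+ 2); last by field.
  have a20' : 0 <= a / 2 by rewrite divr_ge0 // ltW.
  by rewrite -real_normK ?num_real // ltr_pXn2r ?nnegrE // => /ltW.
exists c; first exact: bc.
split; first exact: Zw.
(* Minus the gradient of the penalty, pulled back from the coefficients in the
   frame to the ambient space. *)
exists (- (2 * K / t) *: ((c - c0) *m (pinvmx B)^T)) => y Zy.
have sub : (y - w c <= B)%MS.
  have -> : y - w c = (y - z1) - ((1 - t) *: (y0 - z1) + t *: (c *m B)).
    rewrite -[in RHS](addKr (w c) y); apply/rowP => j; rewrite !mxE; ring.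
  rewrite addmx_sub ?spanB // eqmx_opp addmx_sub // scalemx_sub ?spanB //.
  exact: submxMl.
set v := (y - w c) *m pinvmx B.
have vB : v *m B = y - w c by exact: mulmxKpV.
rewrite -/(w c) dotpZl -dotp_mulmx -/v; clearbody v.
pose s0 := Num.min 1 (a / 2 / ((`|v| + 1) / t)).
have v1 : 0 < (`|v| + 1) / t by rewrite divr_gt0 // ltr_wpDl.
have s00 : 0 < s0 by rewrite lt_min ltr01 !divr_gt0 // ltr_wpDl.
apply: (@ler_addgt0_linear _ _ _ (K * dotp v v / t ^+ 2) s0) => // s s_gt0 ss0.
have s1 : s <= 1 by apply: le_trans ss0 _; rewrite /s0 ge_min lexx.
have sv : s / t * `|v| <= a / 2.
  have : s <= a / 2 / ((`|v| + 1) / t).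
    by apply: le_trans ss0 _; rewrite /s0 ge_min lexx orbT.
  rewrite ler_pdivlMr //; apply: le_trans.
  by rewrite mulrAC -mulrA ler_pM2l // ler_pM2r ?invr_gt0 // lerDl.
have bcs : box (c + (s / t) *: v).
  move=> j; rewrite !mxE.
  have := c_int j.
  have : `|(s / t) * v ord0 j| <= a / 2.
    rewrite normrM gtr0_norm ?divr_gt0 //; apply: le_trans sv.
    by rewrite ler_wpM2l ?coord_le_norm // divr_ge0 // ltW.
  by rewrite !ler_norml => /andP[? ?] /andP[? ?]; apply/andP; split; lra.
have wcs : w (c + (s / t) *: v) = (1 - s) *: w c + s *: y.
  have -> : w (c + (s / t) *: v) = w c + s *: (v *m B).
    rewrite /w mulmxDl -scalemxAl; move: (c *m B) (v *m B) => C D.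
    by apply/rowP => j; rewrite !mxE; field; rewrite gt_eqF.
  by rewrite vB; move: (w c) => W; apply/rowP => j; rewrite !mxE; ring.
have := cmin _ bcs; rewrite /F wcs.
have -> : q (c + (s / t) *: v) = q c + 2 * (s / t) * dotp (c - c0) v + (s / t) ^+ 2 * dotp v v.
  rewrite /q addrAC; move: (c - c0) => b.
  by rewrite !dotpDl !dotpDr !dotpZl !dotpZr (dotpC v); ring.
have := @convex_functionP _ _ _ _ phi_convex s (w c) y (ltW s_gt0) s1 (Zw _ bc) Zy.
set L := phi _; set x := phi (w c); set D := dotp _ v; set E := dotp v v => h1 h2.
rewrite -(ler_pM2l s_gt0).
have -> : s * (x + - (2 * K / t) * D) = s * x - K * (2 * (s / t) * D).
  by field; rewrite gt_eqF.
have -> : s * (phi y + s * (K * E / t ^+ 2)) = s * phi y + K * ((s / t) ^+ 2 * E).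
  by field; rewrite gt_eqF.
rewrite !mulrDr in h2; lra.
Qed.

(** A bound [M] that does not depend on [t] lets points of subdifferentiability
be found arbitrarily close to any point of [Z], and this without [Z] being
closed. *)
Lemma subdiff_dom_contraction : Z !=set0 ->
  exists2 M : R, 0 <= M & forall y (t : R), Z y -> 0 < t -> t <= 1 ->
  exists p, [/\ Z p, `|p| <= M & subdiff_dom Z phi ((1 - t) *: y + t *: p)].
Proof.
move=> [z1 Zz1]; have [k [B [ZB spanB]]] := affine_frame z1.
have S0 : 0 <= \sum_j `|row j B| by rewrite sumr_ge0.
exists (`|z1| + \sum_j `|row j B|); first by rewrite addr_ge0.
move=> y t Zy t0 t1.
have [c c01 cdom] := subdiff_in_simplex Zz1 ZB spanB Zy t0 t1.
exists (z1 + c *m B); split => //; first exact: frame_simplex.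
rewrite (le_trans (ler_normD _ _)) // lerD2l mulmx_sum_row.
rewrite (le_trans (ler_norm_sum _ _ _)) // ler_sum // => j _.
have /andP[cj0 cj1] := c01 j; rewrite normrZ ger0_norm // ler_piMl //.
by rewrite (le_trans cj1) // invf_le1 ?ltr0n // ler1n.
Qed.

Lemma subdiff_dom_dense y (e : R) : Z y -> 0 < e ->
  exists2 w, subdiff_dom Z phi w & `|w - y| < e.
Proof.
move=> Zy e0; have [|M M0 HM] := subdiff_dom_contraction; first by exists y.
have D0 : 0 < e + (M + `|y|) by rewrite ltr_pwDl // addr_ge0.
pose t := e / (e + (M + `|y|)).
have t0 : 0 < t by rewrite divr_gt0.
have t1 : t <= 1 by rewrite ler_pdivrMr // mul1r lerDl addr_ge0.
have [p [Zp pM dom]] := HM y t Zy t0 t1.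
exists ((1 - t) *: y + t *: p) => //.
have -> : (1 - t) *: y + t *: p - y = t *: (p - y).
  by apply/rowP => j; rewrite !mxE; ring.
rewrite normrZ gtr0_norm //.
apply: (@le_lt_trans _ _ (t * (M + `|y|))).
  rewrite ler_pM2l // (le_trans (ler_normB _ _)) // lerD2r //.
by rewrite /t mulrAC ltr_pdivrMr // ltr_pM2l // ltrDr.
Qed.

(** A midpoint of [z] and [y] need not be a point of subdifferentiability, but
it becomes one after a small displacement of [y] alone; [z] stays fixed and the
new point is an exact midpoint. *)
Lemma subdiff_dom_dense_midpoint z y (e : R) : Z z -> Z y -> 0 < e ->
  exists y', [/\ Z y', `|y' - y| < e & subdiff_dom Z phi (2^-1 *: (z + y'))].
Proof.
move=> Zz Zy e0; have [|M M0 HM] := subdiff_dom_contraction; first by exists y.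
have D0 : 0 < e + (M + `|y|) by rewrite ltr_pwDl // addr_ge0.
have D1 : 0 < e + (M + `|y|) + 1 by rewrite ltr_pwDr // ltW.
pose t := e / (e + (M + `|y|) + 1).
have t0 : 0 < t by rewrite divr_gt0.
have t1 : t < 1 by rewrite ltr_pdivrMr // mul1r -addrA ltrDl ltr_wpDl // addr_ge0.
have t2 : 2 - t != 0 by rewrite gt_eqF //; lra.
have t20 : 0 < 2 - t by lra.
pose l := (1 - t) / (2 - t).
have Zl : Z ((1 - l) *: z + l *: y).
  apply: convex_setP => //; first by rewrite divr_ge0 //; lra.
  by rewrite ler_pdivrMr //; lra.
have [||p [Zp pM dom]] := HM _ (t / 2) Zl; [lra|lra|].
exists ((1 - t) *: y + t *: p); split.
- apply: convex_setP => //; lra.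
- have -> : (1 - t) *: y + t *: p - y = t *: (p - y).
    by apply/rowP => j; rewrite !mxE; ring.
  rewrite normrZ gtr0_norm //.
  apply: (@le_lt_trans _ _ (t * (M + `|y|))).
    rewrite ler_pM2l // (le_trans (ler_normB _ _)) // lerD2r //.
  by rewrite /t mulrAC ltr_pdivrMr // ltr_pM2l // -addrA addrCA ltrDl; lra.
- move: dom; congr (subdiff_dom Z phi _); apply/rowP => j; rewrite /l !mxE.
  by field.
Qed.

End Subdifferentiability.

(** * Bregman distances and prox-mappings *)

Section Bregman.
Context {R : realType} {n : nat} {Z : set 'rV[R]_n} (S : prox_setup Z).
Hypothesis Z_convex : convex_set Z.
Implicit Types (x y z g xi : 'rV[R]_n).

Local Notation Zo := (subdiff_dom Z (dgf S)).
Local Notation V := (bregman (dgf S) (dgrad S)).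
Local Notation N := (pnorm S).

Lemma subdiff_dom_sub z : Zo z -> Z z.
Proof. by case. Qed.

Lemma center_subdiff_dom : Zo (Defs.center S).
Proof.
have [Zc cmin] := center_argmin S; split => //.
by exists 0 => z' Zz'; rewrite dotp0l addr0 cmin.
Qed.

Lemma bregman_ge0 z y : Zo z -> Z y -> 0 <= V z y.
Proof.
move=> Zz Zy; have := dgrad_subdiff Zz Zy.
by rewrite /bregman -addrA -opprD subr_ge0.
Qed.

Lemma bregman_refl z : V z z = 0.
Proof. by rewrite /bregman !subrr dotp0r subr0. Qed.

Lemma dgf_le_dgrad_end z w : Z z -> Zo w -> dgf S w <= dgf S z + dotp (dgrad S w) (w - z).
Proof.
move=> Zz Zw; have := dgrad_subdiff Zw Zz.
by rewrite -(opprB w z) dotpNr; lra.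
Qed.

(** By the continuity of [dgrad], the selected subgradient at [z] gives the
directional derivatives of [dgf] at [z] towards all points of [Z]; at a
relative boundary point an arbitrary subgradient only bounds them below. *)
Lemma dgf_directional z y (e : R) : Zo z -> Z y -> 0 < e ->
  exists2 s0 : R, 0 < s0 & forall s, 0 < s -> s <= s0 -> s <= 1 ->
    dgf S (z + s *: (y - z)) <= dgf S z + s * (dotp (dgrad S z) (y - z) + e).
Proof.
move=> Zz Zy e0; have Zz' := subdiff_dom_sub Zz.
set h := y - z.
have h1 : 0 < `|h| + 1 by rewrite ltr_wpDl.
have C0 : 0 < n%:R * (`|h| + 1) + 1 by rewrite ltr_wpDl // mulr_ge0 // ltW.
pose e1 := e / 3 / (n%:R * (`|h| + 1) + 1).
have e10 : 0 < e1 by rewrite !divr_gt0.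
have /within_continuousP/(_ z Zz e1 e10)[r r0 Hr] := @dgrad_continuous _ _ _ S.
exists (r / 2 / (`|h| + 1)); first by rewrite !divr_gt0.
move=> s s0 sr s1.
have Zys : Z (z + s *: h).
  rewrite (_ : z + s *: h = (1 - s) *: z + s *: y).
    by apply: convex_setP => //; exact: ltW.
  by apply/rowP => j; rewrite !mxE; ring.
have se0 : 0 < s * e / 3 by rewrite divr_gt0 // mulr_gt0.
have /within_continuousP/(_ _ Zys _ se0)[r2 r20 Hr2] := @dgf_continuous _ _ _ S.
have G0 : 0 < n%:R * `|dgrad S z| + 1 by rewrite ltr_wpDl // mulr_ge0.
pose dl := Num.min (Num.min r2 s) (s * e / 3 / (n%:R * `|dgrad S z| + 1)).
have dl0 : 0 < dl by rewrite !lt_min r20 s0 divr_gt0.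
have [w Zow wy] :=
  subdiff_dom_dense Z_convex (@dgf_convex _ _ _ S) (@dgf_continuous _ _ _ S) Zys dl0.
have Zw := subdiff_dom_sub Zow.
move: wy; rewrite !lt_min -andbA => /and3P[wy1 wy2 wy3].
have wz : `|w - z| <= s * (`|h| + 1).
  rewrite (_ : w - z = (w - (z + s *: h)) + s *: h); last first.
    by apply/rowP => j; rewrite !mxE; ring.
  rewrite (le_trans (ler_normD _ _)) // normrZ gtr0_norm // mulrDr mulr1 addrC lerD2l.
  exact: ltW.
have wr : `|w - z| < r.
  by apply: le_lt_trans wz _; move: sr; rewrite ler_pdivlMr //; lra.
have dw := Hr w Zow wr.
have := Hr2 w Zw wy1; rewrite ltr_norml => /andP[wphi _].
have := dgf_le_dgrad_end Zz' Zow.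
rewrite (_ : dotp (dgrad S w) (w - z) = s * dotp (dgrad S z) h +
   dotp (dgrad S z) (w - (z + s *: h)) + dotp (dgrad S w - dgrad S z) (w - z)); last first.
  have -> : w - (z + s *: h) = (w - z) - s *: h by rewrite opprD addrA.
  by move: (w - z) => d; rewrite dotpBl (dotpBr _ d) dotpZr; ring.
have b1 : dotp (dgrad S z) (w - (z + s *: h)) <= s * e / 3.
  apply: le_trans (ler_norm _) _; apply: le_trans (dotp_le_norm _ _) _.
  move: wy3; rewrite ltr_pdivlMr // => /ltW; apply: le_trans.
  by rewrite mulrC ler_wpM2l // lerDl.
have b2 : dotp (dgrad S w - dgrad S z) (w - z) <= s * e / 3.
  apply: le_trans (ler_norm _) _; apply: le_trans (dotp_le_norm _ _) _.
  apply: (@le_trans _ _ (n%:R * e1 * (s * (`|h| + 1)))).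
    rewrite -[leLHS]mulrA -[leRHS]mulrA ler_wpM2l //.
    by apply: ler_pM => //; exact: ltW.
  have : e1 * (n%:R * (`|h| + 1) + 1) = e / 3 by rewrite /e1 divfK // gt_eqF.
  move: (n%:R : R) => k; nra.
lra.
Qed.

(** Minimality at the prox-point only controls directional derivatives of
[dgf]; that these are given by the selected subgradient is
[dgf_directional]. *)
Lemma prox_variational z xi y : Zo z -> Z y ->
  0 <= dotp (xi + dgrad S (prox S z xi) - dgrad S z) (y - prox S z xi).
Proof.
move=> Zz Zy; set p := prox S z xi.
have Zop : Zo p := prox_dom xi Zz.
have [Zp pmin] := prox_argmin xi Zz.
rewrite -/p in pmin Zp.
set h := y - p; apply/ler_addgt0Pr => e e0.
have [s0 s00 Hs] := dgf_directional Zop Zy e0.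
pose s := Num.min s0 1.
have s_gt0 : 0 < s by rewrite lt_min s00 ltr01.
have s1 : s <= 1 by rewrite /s ge_min lexx orbT.
have ss0 : s <= s0 by rewrite /s ge_min lexx.
have Zs : Z (p + s *: h).
  rewrite (_ : p + s *: h = (1 - s) *: p + s *: y).
    by apply: convex_setP => //; exact: ltW.
  by apply/rowP => j; rewrite !mxE; ring.
have := pmin _ Zs; have := Hs s s_gt0 ss0 s1; rewrite -/h; clearbody h => h1.
rewrite /bregman (_ : p + s *: h - z = (p - z) + s *: h); last by rewrite addrAC.
rewrite !dotpDr !dotpZr dotpBl dotpDl => h2; rewrite -/p.
by rewrite -(ler_pM2l s_gt0) mulr0; lra.
Qed.

Lemma prox_iterates_dom (T : nat) (v xi : nat -> 'rV[R]_n) :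
  v 1%N = Defs.center S ->
  (forall t, (1 <= t <= T)%N -> v t.+1 = prox S (v t) (xi t)) ->
  forall t, (1 <= t <= T.+1)%N -> Zo (v t).
Proof.
move=> v1 vS [//|t]; elim: t => [|t IH] tT; first by rewrite v1; exact: center_subdiff_dom.
by rewrite vS //; apply: prox_dom; apply: IH; exact: ltnW.
Qed.

Lemma prox_three_point z xi y : Zo z -> Z y ->
  dotp xi (prox S z xi - y) <= V z y - V (prox S z xi) y - V z (prox S z xi).
Proof.
move=> Zz Zy; have := prox_variational xi Zz Zy; move: (prox S z xi) => p.
rewrite /bregman !dotpBr !dotpBl !dotpDl; lra.
Qed.

(** Let [w] be the midpoint of [z] and [y]. The bound [k] on the two halves
contributes [k / 2], and strong monotonicity between [z] and [w] contributes
[1 / 4]. Since [w] must be a point of subdifferentiability, the inequality is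
first obtained at points [y'] close to [y], and then at [y] by continuity. *)
Lemma bregman_ge_improve (k : R) :
  (forall z y, Zo z -> Z y -> k * N (y - z) ^+ 2 <= V z y) ->
  forall z y, Zo z -> Z y -> (k / 2 + 4^-1) * N (y - z) ^+ 2 <= V z y.
Proof.
move=> Hk z y Zoz Zy; have Zz := subdiff_dom_sub Zoz.
set k' := k / 2 + 4^-1; rewrite leNgt; apply/negP => lt_y.
pose F y := V z y - k' * (N (y - z) * N (y - z)).
have Fcont : {within Z, continuous F}.
  have cN : {within Z, continuous (fun y => N (y - z))}.
    have [M M0 HM] := norm_fun_le (pnorm_norm S).
    apply/within_continuousP => a _ e e0; exists (e / M); first by rewrite divr_gt0.
    move=> b _; rewrite ltr_pdivlMr // => ba.
    rewrite (le_lt_trans (norm_fun_dist (pnorm_norm S) _ _)) //.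
    by rewrite opprB addrA subrK (le_lt_trans (HM _)) // mulrC.
  have cV : {within Z, continuous (fun y => dgf S y - dgf S z - dotp (dgrad S z) (y - z))}.
    move=> a; apply: (@continuousB R R (subspace Z) (fun y => dgf S y - dgf S z));
      last exact: dotp_sub_continuous.
    by apply: (@continuousB R R (subspace Z) (dgf S));
      [exact: dgf_continuous|exact: cst_continuous].
  move=> a; apply: (@continuousB R R (subspace Z) (V z)); first exact: cV.
  apply: continuousM; first exact: cst_continuous.
  by apply: continuousM; exact: cN.
have F0 : 0 < - F y by rewrite /F -expr2; lra.
have /within_continuousP/(_ y Zy _ F0)[r r0 Hr] := Fcont.
have [y' [Zy' yy' Zow]] :=
  subdiff_dom_dense_midpoint Z_convex (@dgf_convex _ _ _ S) (@dgf_continuous _ _ _ S) Zz Zy r0.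
have := Hr _ Zy' yy'; rewrite ltr_norml => /andP[_].
set w := 2^-1 *: (z + y') in Zow; have Zw := subdiff_dom_sub Zow.
have wz : w - z = 2^-1 *: (y' - z) by apply/rowP => j; rewrite !mxE; field.
have yw : y' - w = 2^-1 *: (y' - z) by apply/rowP => j; rewrite !mxE; field.
have h1 := Hk _ _ Zoz Zw; have h2 := Hk _ _ Zow Zy'.
have h3 := dgf_strongly_convex Zow Zoz.
rewrite wz in h1 h3; rewrite yw in h2.
move: h1 h2 h3; rewrite /bregman wz yw.
rewrite !dotpZr !dotpBl !(norm_homogeneous (pnorm_norm S)) ger0_norm ?invr_ge0 //.
rewrite /F /bregman /k'; lra.
Qed.

(** The constants [1 / 2 - 2 ^ (- j) / 2], produced by iterating the previous
improvement from [0], tend to [1 / 2]. *)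
Lemma bregman_ge z y : Zo z -> Z y -> N (y - z) ^+ 2 / 2 <= V z y.
Proof.
have H j : forall z y, Zo z -> Z y -> (2^-1 - 2^-1 ^+ j / 2) * N (y - z) ^+ 2 <= V z y.
  elim: j => [|j IH] a b Za Zb.
    by rewrite expr0 mul1r subrr mul0r bregman_ge0.
  rewrite (_ : _ - _ = (2^-1 - 2^-1 ^+ j / 2) / 2 + 4^-1); last by rewrite exprS; field.
  exact: bregman_ge_improve IH _ _ Za Zb.
move=> Zz Zy; apply/ler_addgt0Pr => e e0.
set q := N (y - z) ^+ 2.
have q0 : 0 <= q by exact: sqr_ge0.
have q1 : 0 < q + 1 by rewrite ltr_wpDl.
have [j Hj] : exists j, 2^-1 ^+ j * (q + 1) < e.
  exists (Num.bound ((q + 1) / e)).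
  rewrite exprVn mulrC ltr_pdivrMr ?exprn_gt0 // mulrC -ltr_pdivrMr //.
  exact: upper_nthrootP.
have := H j z y Zz Zy; rewrite -/q.
have p0 : 0 <= 2^-1 ^+ j :> R by rewrite exprn_ge0.
by move: Hj; nra.
Qed.

Lemma prox_step z xi y (G : R) : Zo z -> Z y -> dual_norm N xi <= G ->
  dotp xi (z - y) <= V z y - V (prox S z xi) y + G ^+ 2 / 2.
Proof.
move=> Zz Zy xiG; have := prox_three_point xi Zz Zy.
have := bregman_ge Zz (subdiff_dom_sub (prox_dom xi Zz)).
move: (prox S z xi) => p h1.
have := dotp_le_dual_norm (pnorm_norm S) xi (z - p).
rewrite -(norm_funN (pnorm_norm S) (z - p)) opprB.
have := norm_fun_ge0 (pnorm_norm S) (p - z).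
move: (N (p - z)) h1 => u h1 u0 h2; rewrite !dotpBr in h2 *.
have : dual_norm N xi * u <= G * u by rewrite ler_wpM2r.
have : 0 <= (G - u) ^+ 2 by exact: sqr_ge0.
rewrite expr2 in h1; rewrite !expr2; nra.
Qed.

(** The linear error [dotp (eta - xi) (u - v)] of replacing [eta] by [xi], for
[u] and [v] the prox-points of [xi] and [eta], is at most [|u - z| * |v - u|]
and hence absorbed by the two quadratic terms [V_z(u)] and [V_u(v)] left over by
the three-point inequalities. *)
Lemma mirror_prox_step z xi eta y : Zo z -> Z y ->
  dual_norm N (eta - xi) <= N (prox S z xi - z) ->
  dotp eta (prox S z xi - y) <= V z y - V (prox S z eta) y.
Proof.
move=> Zz Zy; set u := prox S z xi; set v := prox S z eta => small.
have Zu : Zo u := prox_dom xi Zz; have Zv : Zo v := prox_dom eta Zz.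
have h1 := prox_three_point eta Zz Zy; rewrite -/v in h1.
have h2 := prox_three_point xi Zz (subdiff_dom_sub Zv); rewrite -/u in h2.
have h3 := bregman_ge Zz (subdiff_dom_sub Zu).
have h4 := bregman_ge Zu (subdiff_dom_sub Zv).
have h5 := dotp_le_dual_norm (pnorm_norm S) (eta - xi) (u - v).
rewrite -(norm_funN (pnorm_norm S) (u - v)) opprB in h5.
have b0 := norm_fun_ge0 (pnorm_norm S) (v - u).
move: (N (u - z)) (N (v - u)) small h3 h4 h5 b0 => a b small h3 h4 h5 b0.
have h6 : dual_norm N (eta - xi) * b <= a * b by rewrite ler_wpM2r.
have h7 : 0 <= (a - b) ^+ 2 by exact: sqr_ge0.
rewrite !expr2 in h3 h4 h7; rewrite !dotpBl !dotpBr in h5; rewrite !dotpBr in h1 h2 *.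
nra.
Qed.

(** Along rays from [z] the selected subgradient is the exact derivative of
[dgf], so that [g - al *: dgrad S z] is a subgradient at [z] of the convex
function [phi - al * dgf]. *)
Lemma subgradient_strongly_convex (phi : 'rV[R]_n -> R) (al : R) z g y :
  0 < al -> convex_function Z (fun x => phi x - al * dgf S x) ->
  Zo z -> subdiff Z phi z g -> Z y ->
  phi z + dotp g (y - z) + al * V z y <= phi y.
Proof.
move=> al0 cphi Zoz sg Zy; have Zz := subdiff_dom_sub Zoz.
apply/ler_addgt0Pr => e e0.
have [s0 s00 Hs] := dgf_directional Zoz Zy (divr_gt0 e0 al0).
pose s := Num.min s0 1.
have s_gt0 : 0 < s by rewrite lt_min s00 ltr01.
have s1 : s <= 1 by rewrite /s ge_min lexx orbT.
have ss0 : s <= s0 by rewrite /s ge_min lexx.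
have h1 := Hs s s_gt0 ss0 s1.
have h2 := convex_functionP cphi (ltW s_gt0) s1 Zz Zy.
have zs : (1 - s) *: z + s *: y = z + s *: (y - z).
  by apply/rowP => j; rewrite !mxE; ring.
have Zs : Z (z + s *: (y - z)) by rewrite -zs; apply: convex_setP => //; exact: ltW.
have h3 := sg _ Zs; rewrite zs in h2.
rewrite addrAC subrr add0r dotpZr in h3.
have h4 : al * dgf S (z + s *: (y - z)) <= al * dgf S z + s * (al * dotp (dgrad S z) (y - z) + e).
  apply: le_trans (ler_wpM2l (ltW al0) h1) _.
  by rewrite le_eqVlt; apply/orP; left; apply/eqP; field; rewrite gt_eqF.
by rewrite -(ler_pM2l s_gt0) /bregman; lra.
Qed.

End Bregman.

(** * Linearly growing weights *)

Section LinearWeights.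
Context {R : realType}.

Lemma linear_weight_gt0 T t : (0 < T)%N -> (0 < t)%N -> 0 < linear_weight T t :> R.
Proof. by move=> T0 t0; rewrite divr_gt0 // ltr0n muln_gt0 ?T0. Qed.

Lemma linear_weight_ge0 T t : 0 <= linear_weight T t :> R.
Proof. by rewrite divr_ge0. Qed.

Lemma linear_weight_sum T : (0 < T)%N -> \sum_(1 <= t < T.+1) linear_weight T t = 1 :> R.
Proof.
move=> T0; rewrite /linear_weight -mulr_suml -natr_sum.
have -> : (\sum_(1 <= t < T.+1) 2 * t = T * T.+1)%N.
  by elim: T {T0} => [|T IH]; [rewrite big_geq|rewrite big_nat_recr //= IH -mulnDl addn2 mulnC].
by rewrite divff // pnatr_eq0 -lt0n muln_gt0 T0.
Qed.

Lemma linear_weight_last T : (0 < T)%N -> linear_weight T T = 2 / T.+1%:R :> R.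
Proof.
move=> T0; have T0' : T%:R != 0 :> R by rewrite pnatr_eq0 -lt0n.
by rewrite /linear_weight !natrM invfM mulrA mulfK.
Qed.

Lemma linear_weight_le T t : (t <= T)%N -> linear_weight T t <= linear_weight T T :> R.
Proof.
by move=> tT; rewrite ler_wpM2r ?invr_ge0 // ler_nat leq_mul2l tT.
Qed.

Lemma sup_linear_weight T : (0 < T)%N ->
  sup [set linear_weight T s | s in [set s | (1 <= s <= T)%N]] = 2 / T.+1%:R :> R.
Proof.
move=> T0; rewrite -linear_weight_last //.
apply/eqP; rewrite eq_le; apply/andP; split.
  apply: ge_sup; first by exists (linear_weight T T), T => //=; rewrite T0 leqnn.
  by move=> _ [s /andP[_ sT] <-]; exact: linear_weight_le.
apply: ub_le_sup.
  by exists (linear_weight T T) => _ [s /andP[_ sT] <-]; exact: linear_weight_le.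
by exists T => //=; rewrite T0 leqnn.
Qed.

Lemma convex_set_linear_weight n (Z : set 'rV[R]_n) T (x : nat -> 'rV[R]_n) :
  convex_set Z -> (0 < T)%N -> (forall t, (1 <= t <= T)%N -> Z (x t)) ->
  Z (\sum_(1 <= t < T.+1) linear_weight T t *: x t).
Proof.
case: T => // T cZ T0 Zx; have := linear_weight_sum T0.
rewrite big_ltn // [X in _ -> Z X]big_ltn // !big_add1 /= !big_mkord => e.
apply: (convex_set_sum cZ) => //.
- exact: Zx.
- exact: linear_weight_gt0.
- by move=> t; exact: linear_weight_ge0.
- by move=> t; apply: Zx => /=; exact: ltn_ord.
Qed.

(** A single subgradient at the average suffices for Jensen's inequality. *)
Lemma linear_weight_jensen n (Z : set 'rV[R]_n) T (phi : 'rV[R]_n -> R)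
    (x : nat -> 'rV[R]_n) g :
  (0 < T)%N -> (forall t, (1 <= t <= T)%N -> Z (x t)) ->
  subdiff Z phi (\sum_(1 <= t < T.+1) linear_weight T t *: x t) g ->
  phi (\sum_(1 <= t < T.+1) linear_weight T t *: x t)
    <= \sum_(1 <= t < T.+1) linear_weight T t * phi (x t).
Proof.
move=> T0 Zx; set xb := \sum_(1 <= t < T.+1) _ => sg.
have avg (c : R) : \sum_(1 <= t < T.+1) linear_weight T t * c = c.
  by rewrite -mulr_suml linear_weight_sum // mul1r.
apply: (@le_trans _ _ (\sum_(1 <= t < T.+1)
    linear_weight T t * (phi xb + dotp g (x t - xb)))).
  rewrite (eq_bigr (fun t => linear_weight T t * (phi xb - dotp g xb)
    + dotp g (linear_weight T t *: x t))); last first.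
    by move=> t _; rewrite dotpZr dotpBr; ring.
  by rewrite big_split /= avg -dotp_sumr -/xb subrK.
by apply: ler_sum_nat => t tT; rewrite ler_wpM2l ?linear_weight_ge0 //; apply/sg/Zx.
Qed.

End LinearWeights.

(** * Regret bounds *)

(** With step size [2 / (al * (t + 1))], step [t] multiplied by [t] involves
[V_t] with coefficient [al * t * (t + 1) / 2 - al * t = al * t * (t - 1) / 2],
the second term coming from strong convexity, and [- V_(t+1)] with coefficient
[al * t * (t + 1) / 2]. These telescope from [0], and every step leaves an error
of at most [G ^+ 2 / al]. *)
Lemma strongly_convex_regret (R : realType) (n : nat) (Z : set 'rV[R]_n)
    (S : prox_setup Z) (al G : R) (T : nat) (phi : nat -> 'rV[R]_n -> R)
    (g x : nat -> 'rV[R]_n) (y : 'rV[R]_n) :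
  convex_set Z -> 0 < al -> (0 < T)%N ->
  (forall t, (1 <= t <= T)%N -> Z (x t) -> subdiff Z (phi t) (x t) (g t)) ->
  (forall t, (1 <= t <= T)%N -> Z (x t) -> dual_norm (pnorm S) (g t) <= G) ->
  (forall t, (1 <= t <= T)%N -> exists2 a, al <= a &
     convex_function Z (fun z => phi t z - a * dgf S z)) ->
  x 1%N = Defs.center S ->
  (forall t, (1 <= t <= T)%N -> x t.+1 = prox S (x t) ((2 / (al * t.+1%:R)) *: g t)) ->
  Z y ->
  \sum_(1 <= t < T.+1) linear_weight T t * (phi t (x t) - phi t y)
    <= 2 * G ^+ 2 / (al * T.+1%:R).
Proof.
move=> cZ al0 T0 sg gG sc x1 xS Zy.
have Zx := prox_iterates_dom x1 xS.
pose V t := bregman (dgf S) (dgrad S) (x t) y.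
pose W t : R := al * t%:R * (t%:R - 1) / 2 * V t.
have step t : (1 <= t < T.+1)%N ->
    t%:R * (phi t (x t) - phi t y) <= - (W t.+1 - W t) + G ^+ 2 / al.
  move=> tT; have tT' : (1 <= t <= T.+1)%N by case/andP: tT => -> /ltnW.
  have Zot := Zx _ tT'; have Zt := subdiff_dom_sub Zot.
  have [a ala ca] := sc _ tT.
  have V0 : 0 <= V t by exact: bregman_ge0.
  have h1 := subgradient_strongly_convex cZ (lt_le_trans al0 ala) ca Zot (sg t tT Zt) Zy.
  have k0 : 1 <= t%:R :> R by rewrite ler1n; case/andP: tT.
  pose eta : R := 2 / (al * t.+1%:R).
  have eta0 : 0 < eta by rewrite divr_gt0 // mulr_gt0.
  have etaG : dual_norm (pnorm S) (eta *: g t) <= eta * G.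
    apply: le_trans (dual_norm_scale (pnorm_norm S) _ _) _.
    by rewrite gtr0_norm // ler_pM2l // gG.
  have := prox_step cZ Zot Zy etaG; rewrite -xS // -/(V t) -/(V t.+1) dotpZl.
  rewrite -(opprB y) dotpNr; move: (dotp (g t) (y - x t)) h1 => D h1 h2.
  rewrite -/(V t) in h1.
  have h3 : al * V t <= a * V t by rewrite ler_wpM2r.
  have ES : t.+1%:R = t%:R + 1 :> R by rewrite -natr1.
  have k1 : 0 < t%:R + 1 :> R by rewrite ltr_wpDl.
  rewrite /W ES; rewrite /eta ES in h2; move: (t%:R : R) k0 k1 h2 => k k0 k1 h2.
  have c0 : 0 < al * k * (k + 1) / 2 by rewrite divr_gt0 // !mulr_gt0 //; lra.
  move: h2; rewrite -(ler_pM2l c0).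
  have -> : al * k * (k + 1) / 2 * (2 / (al * (k + 1)) * - D) = - k * D.
    by field; rewrite !gt_eqF.
  have -> : al * k * (k + 1) / 2 * (V t - V t.+1 + (2 / (al * (k + 1)) * G) ^+ 2 / 2) =
     al * k * (k + 1) / 2 * V t - al * (k + 1) * k / 2 * V t.+1 + k / (k + 1) * (G ^+ 2 / al).
    by field; rewrite !gt_eqF.
  have h4 : k / (k + 1) * (G ^+ 2 / al) <= G ^+ 2 / al.
    rewrite ler_piMl //; first by rewrite divr_ge0 ?sqr_ge0 // ltW.
    by rewrite ler_pdivrMr // mul1r lerDl.
  have h5 : k * (phi t (x t) - phi t y) <= k * (- D - al * V t).
    by rewrite ler_wpM2l //; lra.
  move=> h2; rewrite (_ : k + 1 - 1 = k); last by ring.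
  lra.
have T0R : 0 < T%:R :> R by rewrite ltr0n.
have T1R : 0 < T.+1%:R :> R by rewrite ltr0n.
have W1 : W 1%N = 0 by rewrite /W subrr mulr0 !mul0r.
have WT : 0 <= W T.+1.
  rewrite /W -natr1 addrK mulr_ge0 //; last first.
    by apply: bregman_ge0 => //; apply: Zx => /=; rewrite leqnn.
  by rewrite divr_ge0 // !mulr_ge0 // ?ltW //; lra.
have total : \sum_(1 <= t < T.+1) t%:R * (phi t (x t) - phi t y) <= T%:R * (G ^+ 2 / al).
  apply: le_trans (ler_sum_nat step) _.
  rewrite big_split sumrN /= telescope_sumr // W1 sumr_const_nat subn1 /=.
  by rewrite -[G ^+ 2 / al *+ T]mulr_natl; lra.
have c0 : 0 < 2 / (T * T.+1)%:R :> R by rewrite natrM divr_gt0 // mulr_gt0.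
have -> : \sum_(1 <= t < T.+1) linear_weight T t * (phi t (x t) - phi t y) =
   2 / (T * T.+1)%:R * \sum_(1 <= t < T.+1) t%:R * (phi t (x t) - phi t y).
  by rewrite mulr_sumr; apply: eq_bigr => t _; rewrite /linear_weight natrM; ring.
apply: le_trans (ler_wpM2l (ltW c0) total) _.
rewrite natrM; move: (T.+1%:R : R) T1R => T1 T1R.
by rewrite le_eqVlt; apply/orP; left; apply/eqP; field; rewrite !gt_eqF.
Qed.

(** The condition [gam * theta t * L <= 1] is what makes every step error-free,
so that only the initial Bregman distance is left. *)
Lemma mirror_prox_regret (R : realType) (n : nat) (Z : set 'rV[R]_n)
    (S : prox_setup Z) (L gam : R) (T : nat) (theta : nat -> R)
    (F : nat -> 'rV[R]_n -> R) (G : nat -> 'rV[R]_n -> 'rV[R]_n)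
    (u v : nat -> 'rV[R]_n) (y : 'rV[R]_n) :
  convex_set Z -> 0 <= gam ->
  (forall t, (1 <= t <= T)%N -> 0 <= theta t /\ gam * theta t * L <= 1) ->
  (forall t z, (1 <= t <= T)%N -> Z z -> superdiff Z (F t) z (G t z)) ->
  (forall t z z', (1 <= t <= T)%N -> Z z -> Z z' ->
     dual_norm (pnorm S) (G t z - G t z') <= L * pnorm S (z - z')) ->
  v 1%N = Defs.center S ->
  (forall t, (1 <= t <= T)%N ->
     u t = prox S (v t) (- ((gam * theta t) *: G t (v t)))) ->
  (forall t, (1 <= t <= T)%N ->
     v t.+1 = prox S (v t) (- ((gam * theta t) *: G t (u t)))) ->
  Z y ->
  gam * \sum_(1 <= t < T.+1) theta t * (F t y - F t (u t)) <= width S.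
Proof.
move=> cZ gam0 th sG lG v1 uS vS Zy.
have Zv := prox_iterates_dom v1 vS.
pose V t := bregman (dgf S) (dgrad S) (v t) y.
have step t : (1 <= t < T.+1)%N ->
    gam * (theta t * (F t y - F t (u t))) <= - (V t.+1 - V t).
  move=> tT; have tT' : (1 <= t <= T.+1)%N by case/andP: tT => -> /ltnW.
  have Zvt := Zv _ tT'; have [th0 thL] := th t tT.
  have Zut : subdiff_dom Z (dgf S) (u t) by rewrite uS //; exact: prox_dom.
  have c0 : 0 <= gam * theta t by rewrite mulr_ge0.
  have Zvt' := subdiff_dom_sub Zvt; have Zut' := subdiff_dom_sub Zut.
  have small : dual_norm (pnorm S)
      (- ((gam * theta t) *: G t (u t)) - - ((gam * theta t) *: G t (v t)))
      <= pnorm S (u t - v t).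
    rewrite -opprD -scalerBr -scaleNr.
    apply: le_trans (dual_norm_scale (pnorm_norm S) _ _) _.
    rewrite normrN ger0_norm //; apply: le_trans (ler_wpM2l c0 (lG t _ _ tT Zut' Zvt')) _.
    by rewrite mulrA ler_piMl // norm_fun_ge0 //; exact: pnorm_norm.
  rewrite {2}(uS t tT) in small.
  have := mirror_prox_step cZ Zvt Zy small; rewrite -uS // -vS // -/(V t) -/(V t.+1).
  rewrite dotpNl dotpZl -(opprB y) dotpNr mulrN opprK => h1.
  have h2 := sG t _ tT Zut' y Zy.
  have : gam * theta t * (F t y - F t (u t)) <= gam * theta t * dotp (G t (u t)) (y - u t).
    by rewrite ler_wpM2l //; lra.
  by rewrite mulrA; lra.
rewrite mulr_sumr; apply: le_trans (ler_sum_nat step) _.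
rewrite sumrN telescope_sumr // opprB.
have : 0 <= V T.+1 by apply: bregman_ge0 => //; apply: Zv => /=; rewrite leqnn.
have : V 1%N <= width S by rewrite /V v1; exact: width_ub.
by lra.
Qed.

(** * Robust feasibility *)

Theorem theorem9 (R : realType) (n m : nat) (d : 'I_m.+1 -> nat)
  (X : set 'rV[R]_n) (U : forall i, set 'rV[R]_(d i))
  (X_convex : convex_set X) (U_convex : forall i, convex_set (U i))
  (SX : prox_setup X) (SU : forall i, prox_setup (U i))
  (OmegaU : R) (width_U : forall i, width (SU i) <= OmegaU)
  (f : forall i, 'rV[R]_n -> 'rV[R]_(d i) -> R)
  (f_convex : forall i u, U i u -> convex_function X (fun x => f i x u))
  (f_concave : forall i x, X x -> convex_function (U i) (fun u => - f i x u))
  (gx : forall i, 'rV[R]_n -> 'rV[R]_(d i) -> 'rV[R]_n)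
  (gu : forall i, 'rV[R]_n -> 'rV[R]_(d i) -> 'rV[R]_(d i))
  (gx_subgradient : forall i x u, X x -> U i u ->
     subdiff X (fun x' => f i x' u) x (gx i x u))
  (gu_supergradient : forall i x u, X x -> U i u ->
     superdiff (U i) (f i x) u (gu i x u))
  (GX GU : R)
  (gx_bounded : forall i x u, X x -> U i u ->
     dual_norm (pnorm SX) (gx i x u) <= GX)
  (gu_bounded : forall i x u, X x -> U i u ->
     dual_norm (pnorm (SU i)) (gu i x u) <= GU)
  (LU : R) (LU_gt0 : 0 < LU)
  (gu_lipschitz : forall i x u u', X x -> U i u -> U i u' ->
     dual_norm (pnorm (SU i)) (gu i x u - gu i x u')
       <= LU * pnorm (SU i) (u - u'))
  (alpha : 'I_m.+1 -> R) (alpha_gt0 : forall i, 0 < alpha i)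
  (f_strongly_convex : forall i u, U i u ->
     convex_function X (fun x => f i x u - alpha i * dgf SX x))
  (alphaX : R)
  (alphaX_min : alphaX = \big[Num.min/alpha ord0]_(i < m.+1) alpha i)
  (tau : R) (tau01 : 0 < tau < 1) :
  exists2 C : R, 0 < C &
    forall eps : R, 0 < eps ->
    forall T : nat, (0 < T)%N -> C / eps <= T%:R ->
    forall (x : nat -> 'rV[R]_n) (u v : forall i, nat -> 'rV[R]_(d i))
      (it : nat -> 'I_m.+1),
    robust_run f SX SU gx gu LU alphaX T x u v it ->
    correct_output X U f eps (decision f eps tau T (linear_weight T) x u).

Proof.
have [tau0 tau1] := andP tau01.
have alX_le i : alphaX <= alpha i by rewrite alphaX_min bigmin_le.
have alX0 : 0 < alphaX.
  rewrite alphaX_min; elim/big_ind: _ => // a b a0 b0.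
  by rewrite lt_min a0.
(* [Cx] brings the regret of the [x]-iterates down to [(1 - tau) * eps], and
   [Cu] that of the [u]-iterates down to [tau * eps]; adding [1] makes the
   constant positive. *)
pose Cx := 2 * GX ^+ 2 / (alphaX * (1 - tau)).
pose Cu := 2 * OmegaU * LU / tau.
have OU0 : 0 <= OmegaU.
  apply: le_trans (width_U ord0).
  have [Zc _] := center_argmin (SU ord0).
  by have := width_ub (SU ord0) Zc; rewrite bregman_refl.
have tau1' : 0 < 1 - tau by lra.
have Cx0 : 0 <= Cx by rewrite divr_ge0 // mulr_ge0 ?sqr_ge0 //; exact: ltW.
have Cu0 : 0 <= Cu by rewrite divr_ge0 ?mulr_ge0 //; exact: ltW.
exists (1 + Cx + Cu); first by lra.
move=> eps eps0 T T0 CT x u v it run.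
have T1R : 0 < T.+1%:R :> R by rewrite ltr0n.
have CT1 : 1 + Cx + Cu <= eps * T.+1%:R.
  move: CT; rewrite ler_pdivrMr // mulrC => /le_trans; apply.
  by rewrite ler_pM2l // ler_nat.
have Xx t : (1 <= t <= T)%N -> X (x t).
  move=> /andP[t1 tT]; apply: (@subdiff_dom_sub _ _ _ SX).
  by apply: (prox_iterates_dom (run_x1 run) (run_x run)); rewrite t1 leqW.
have Uu i t : (1 <= t <= T)%N -> U i (u i t).
  move=> tT; apply: (@subdiff_dom_sub _ _ _ (SU i)); rewrite (run_u run) //.
  apply: prox_dom; apply: (prox_iterates_dom (run_v1 run i) (run_v run i)).
  by case/andP: tT => -> /leqW.
have regU i y : U i y ->
    \sum_(1 <= t < T.+1) linear_weight T t * f i (x t) y <=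
    \sum_(1 <= t < T.+1) linear_weight T t * f i (x t) (u i t) + tau * eps.
  move=> Uy.
  have gam0 : 0 < dual_step LU T.
    by rewrite /dual_step sup_linear_weight // invr_gt0 mulr_gt0 // divr_gt0.
  have := @mirror_prox_regret R _ (U i) (SU i) LU (dual_step LU T) T (linear_weight T)
    (fun t => f i (x t)) (fun t => gu i (x t)) (u i) (v i) y (U_convex i) (ltW gam0).
  have h1 t : (1 <= t <= T)%N -> 0 <= linear_weight T t :> R /\
      dual_step LU T * linear_weight T t * LU <= 1.
    move=> /andP[_ tT]; split; first exact: linear_weight_ge0.
    rewrite /dual_step sup_linear_weight // -linear_weight_last // -mulrA.
    have thT : 0 < LU * linear_weight T T by rewrite mulr_gt0 // linear_weight_gt0.
    rewrite ler_pdivrMl // mulr1 mulrC ler_pM2l //.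
    exact: linear_weight_le.
  move=> /(_ h1 (fun t z tT => gu_supergradient i (x t) z (Xx t tT))).
  move=> /(_ (fun t z z' tT => gu_lipschitz i (x t) z z' (Xx t tT))).
  move=> /(_ (run_v1 run i) (run_u run i) (run_v run i) Uy).
  set reg := \sum_(1 <= t < T.+1) _ => hreg.
  have : reg <= tau * eps.
    rewrite -(ler_pM2l gam0); apply: le_trans hreg _.
    apply: le_trans (width_U i) _.
    rewrite /dual_step sup_linear_weight // mulrC ler_pdivlMr; last first.
      by rewrite mulr_gt0 // divr_gt0.
    rewrite !mulrA ler_pdivrMr // -mulrA.
    have : Cu <= eps * T.+1%:R by lra.
    rewrite ler_pdivrMr // => h; lra.
  rewrite /reg (eq_bigr (fun t => linear_weight T t * f i (x t) y -
    linear_weight T t * f i (x t) (u i t))); last by move=> t _; rewrite mulrBr.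
  by rewrite sumrB; lra.
rewrite /decision.
pose S i := \sum_(1 <= t < T.+1) linear_weight T t * f i (x t) (u i t).
case: ifP => [small|/negbT large]; rewrite /correct_output.
  have Xb := convex_set_linear_weight X_convex T0 Xx.
  split => // i; apply: ge_ereal_sup => _ [y Uy <-]; rewrite lee_fin.
  have Si : S i <= (1 - tau) * eps by apply: le_trans small; exact: (le_bigmax _ S).
  apply: le_trans (linear_weight_jensen T0 Xx (gx_subgradient i _ y Xb Uy)) _.
  by have := regU i y Uy; rewrite -/(S i); lra.
(* If [y] satisfied all constraints, every [f (it t) y _] would be nonpositive,
   and the regret bound against [y] would contradict the failed test. *)
move=> y Xy; apply: contrapT => noi; move: large; apply/negP; rewrite negbK.
have fy0 i w : U i w -> f i y w <= 0.
  move=> Uw; rewrite leNgt; apply/negP => f0; apply: noi; exists i.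
  apply: (@lt_le_trans _ _ (f i y w)%:E); first by rewrite lte_fin.
  by apply: ereal_sup_ubound; exists w.
have := @strongly_convex_regret R n X SX alphaX GX T
  (fun t z => f (it t) z (u (it t) t)) (fun t => gx (it t) (x t) (u (it t) t)) x y
  X_convex alX0 T0.
move=> /(_ (fun t tT Xt => gx_subgradient _ _ _ Xt (Uu _ t tT))).
move=> /(_ (fun t tT Xt => gx_bounded _ _ _ Xt (Uu _ t tT))).
have h1 t : (1 <= t <= T)%N -> exists2 a, alphaX <= a &
    convex_function X (fun z => f (it t) z (u (it t) t) - a * dgf SX z).
  by move=> tT; exists (alpha (it t)) => //; exact: f_strongly_convex (Uu _ t tT).
move=> /(_ h1 (run_x1 run) (run_x run) Xy) reg.
have {}reg : \sum_(1 <= t < T.+1) linear_weight T t * f (it t) (x t) (u (it t) t)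
    <= (1 - tau) * eps.
  apply: le_trans (le_trans reg _).
    apply: ler_sum_nat => t tT; rewrite ler_wpM2l ?linear_weight_ge0 //.
    by have := fy0 _ _ (Uu (it t) t tT); lra.
  rewrite ler_pdivrMr ?mulr_gt0 //.
  have : Cx <= eps * T.+1%:R by lra.
  rewrite ler_pdivrMr ?mulr_gt0 // => h; lra.
have Sle i : S i <= (1 - tau) * eps.
  apply: le_trans reg; apply: ler_sum_nat => t tT.
  by rewrite ler_wpM2l ?linear_weight_ge0 // (run_it run).
by apply: bigmax_le => [|i _]; exact: Sle.
Qed.
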